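(* Let $\theta\in[0,\pi/2)$, $\mathbf{p}=(\cos\theta,\sin\theta)$ and $C_\theta=\cos\theta+\sin\theta$. Let $X=\{\mathbf{x}_j\}_{j=1}^n$ be a sequence of independent random variables drawn from a probability distribution on $\mathcal{E}_K$ whose density $\xi$ satisfies $0<C_{\xi,l}\le\xi(\mathbf{x})\le C_{\xi,u}$ for all $\mathbf{x}\in\mathcal{E}_K$. Suppose that the sequence $\{\mathcal{R}_{\mathbf{p}}\varphi(\cdot-\mathbf{p}\cdot\mathbf{k}_l)\}_{l=1}^{\mathcal{Q}}$ is linearly independent, where $\{\mathbf{k}_1,\ldots,\mathbf{k}_{\mathcal{Q}}\}=E=\left[\lceil -N-K\rceil,\lfloor K+N\rfloor\right]^2\cap\mathbb{Z}^2$ and $\mathcal{Q}$ is the cardinality of $E$. Then there exist constants $C_{1,\mathbf{p}},C_{2,\mathbf{p}}$ with $0<C_{1,\mathbf{p}}\le C_{2,\mathbf{p}}<\infty$ and a constant $\gamma$ with $0<\gamma<\frac{2KC_{1,\mathbf{p}}C_{\xi,l}}{M_2^2}$ such that the sampling inequality $$\left[\frac{2KC_{1,\mathbf{p}}C_{\xi,l}}{M_2^2}-\gamma\right]\|f\|_{L^2(\mathcal{E}_K)}^2\le\frac1n\sum_{j=1}^n\left|\mathcal{R}_{\mathbf{p}}(f(\mathbf{x}_j))\right|^2\le\left[\frac{2\sqrt2KC_{2,\mathbf{p}}C_{\xi,u}}{m_2^2}+\gamma\right]\|f\|_{L^2(\mathcal{E}_K)}^2\quad\text{for all } f\in\mathcal{S}_{N,K}(\varphi)$$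 holds with probability at least $$1-\mathcal{Q}\exp\left(-\frac{nm_2^4\gamma^2}{8K^2C_\theta^2M_2^2\left[4K^2C_\theta^2C_\varphi^2C_{\xi,u}+\frac{\gamma\left(C_\varphi^2+C_{\xi,u}m_2^2\right)}{3}\right]}\right).$$
   Context: $N,K>0$ are fixed, $\mathcal{E}_K=[-K,K]^2$, and it is assumed throughout that $\mathcal{Q}>1$. The generator $\varphi:\mathbb{R}^2\to\mathbb{R}$ is continuous with compact support contained in $[-N,N]^2$ and has stable shifts: there are constants $0<m_2\le M_2<\infty$ such that for every $C=(c_{\mathbf{k}_l})_{l=1}^{\mathcal{Q}}$, $$m_2\|C\|_{\ell^2}\le\Big\|\sum_{l=1}^{\mathcal{Q}}c_{\mathbf{k}_l}\varphi(\cdot-\mathbf{k}_l)\Big\|_{L^2(\mathcal{E}_K)}\le M_2\|C\|_{\ell^2}.$$ The signal space is $$\mathcal{S}_{N,K}(\varphi)=\Big\{f:\ f(\mathbf{x})=\sum_{l=1}^{\mathcal{Q}}c_{\mathbf{k}_l}\varphi(\mathbf{x}-\mathbf{k}_l),\ c_{\mathbf{k}_l}\in\mathbb{R},\ \mathbf{x}\in\mathcal{E}_K\Big\}.$$ Also $C_\varphi=\sup_{\mathbf{x}\in\mathcal{E}_K}\sum_{l=1}^{\mathcal{Q}}|\varphi(\mathbf{x}-\mathbf{k}_l)|$. Radon transform: for $g:\mathbb{R}^2\to\mathbb{R}$, $$\mathcal{R}_{\mathbf{p}}g(t)=\int_{-\infty}^{\infty}g(t\cos\theta-s\sin\theta,\,t\sin\theta+s\cos\theta)\,ds,\quad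 t\in\mathbb{R}.$$ The notation $\mathcal{R}_{\mathbf{p}}(g(\mathbf{x}))$ for $\mathbf{x}\in\mathcal{E}_K$ means $\mathcal{R}_{\mathbf{p}}g(\mathbf{p}\cdot\mathbf{x})$. For $f=\sum_l c_{\mathbf{k}_l}\varphi(\cdot-\mathbf{k}_l)\in\mathcal{S}_{N,K}(\varphi)$, the Radon transform is taken of this finite sum, so $\mathcal{R}_{\mathbf{p}}(f(\mathbf{x}))=\sum_{l=1}^{\mathcal{Q}}c_{\mathbf{k}_l}\mathcal{R}_{\mathbf{p}}\varphi(\mathbf{p}\cdot\mathbf{x}-\mathbf{p}\cdot\mathbf{k}_l)$.
   Formalization: Linear independence of the shifted Radon transforms is required as functions on the sampled set {p·x : x in E_K}, not on the whole real line; with independence on the whole line only, the lower sampling bound can fail. *)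

(* Defs.v *)
From HB Require Import structures.
From mathcomp Require Import all_boot all_order all_algebra finmap.
From mathcomp Require Import all_classical all_reals all_analysis.

Set Implicit Arguments.
Unset Strict Implicit.
Unset Printing Implicit Defensive.

Import Order.TTheory GRing.Theory Num.Theory.
Import numFieldNormedType.Exports.

Local Open Scope classical_set_scope.
Local Open Scope ring_scope.

(* The carrier is R * R; [measurableTypeR R] is R with its Borel sigma-algebra,
   on which [lebesgue_measure] is defined. *)
Notation plane R := (measurableTypeR R * measurableTypeR R)%type.

Section Plane.
Context {R : realType}.
Implicit Types (N K theta t : R) (phi g : R * R -> R) (c : int * int -> R).

Definition square K : set (R * R) := `[- K, K] `*` `[- K, K].

Definition lebesgue2 : {measure set (plane R) -> \bar R} :=
  (@lebesgue_measure R \x @lebesgue_measure R)%E.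

Definition dotp (x y : R * R) : R := x.1 * y.1 + x.2 * y.2.

Definition direction theta : R * R := (cos theta, sin theta).

Definition lattice_pt (k : int * int) : R * R := (k.1%:~R, k.2%:~R).

(* The underlying set is finite, so [fset_set] is faithful. *)
Definition lattice_index N K : {fset int * int} :=
  fset_set [set k : int * int |
    (Num.ceil (- N - K) <= k.1 <= Num.floor (K + N)) /\
    (Num.ceil (- N - K) <= k.2 <= Num.floor (K + N))].

Definition supp g : set (R * R) := closure [set x | g x != 0].

(* Only the values of [c] on [lattice_index N K] matter: [c] encodes the
   coefficient vector indexed by that finite set. *)
Definition shift_comb N K phi c (x : R * R) : R :=
  \sum_(k <- lattice_index N K) c k * phi (x - lattice_pt k).

Definition l2norm N K c : R :=
  Num.sqrt (\sum_(k <- lattice_index N K) c k ^+ 2).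

Definition L2norm (D : set (R * R)) g : R :=
  Num.sqrt (\int[lebesgue2]_(x in D) (`|g x| ^+ 2)).

Definition stable_shifts N K phi (m M : R) : Prop :=
  forall c,
    m * l2norm N K c <= L2norm (square K) (shift_comb N K phi c)
      <= M * l2norm N K c.

(* Elements of the signal space are given by their defining finite sums on the
   whole plane; the Radon transform needs the values outside [square K]. *)
Definition signal_space N K phi : set (R * R -> R) :=
  [set f | exists c, f = shift_comb N K phi c].

Definition sup_shifts N K phi : R :=
  sup [set \sum_(k <- lattice_index N K) `|phi (x - lattice_pt k)|
      | x in square K].

Definition radon theta g t : R :=
  \int[lebesgue_measure]_(s in setT)
    g (t * cos theta - s * sin theta, t * sin theta + s * cos theta).

(* [radon_at theta g x] is what is meant by the Radon transform of g(x) at a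
   point x of the plane. *)
Definition radon_at theta g (x : R * R) : R :=
  radon theta g (dotp (direction theta) x).

(* Linear independence of the functions R_p phi(. - p . k) of the variable
   p . x, for x in [square K], which is where Radon samples are taken.
   Independence as functions on the whole line is strictly weaker (some
   R_p phi(. - p . k) may be nonzero and yet vanish on {p . x | x in square K})
   and cannot give a lower sampling bound. *)
Definition radon_shifts_independent N K theta phi : Prop :=
  forall c,
    (forall x, square K x ->
       \sum_(k <- lattice_index N K)
         c k * radon theta phi (dotp (direction theta) x
                                - dotp (direction theta) (lattice_pt k)) = 0) ->
    forall k, k \in lattice_index N K -> c k = 0.

End Plane.

Section Sampling.
Context {R : realType} (d : measure_display) (T : measurableType d)
  (P : probability T R).

(* Mutual independence; taking some of the A j to be [setT] gives the product
   rule for all subfamilies. *)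
Definition mutually_independent (n : nat) d' (T' : measurableType d')
    (X : 'I_n -> {RV P >-> T'}) : Prop :=
  forall A : 'I_n -> set T', (forall j, measurable (A j)) ->
    P (\bigcap_j (X j @^-1` A j)) = (\prod_(j < n) P (X j @^-1` A j))%E.

(* [xi] is a density on [D] of the law of [Y]; taking A = ~` D, the law is
   concentrated on [D]. *)
Definition has_density_on (D : set (plane R)) (xi : plane R -> R)
    (Y : {RV P >-> plane R}) : Prop :=
  measurable_fun D xi /\
  forall A : set (plane R), measurable A ->
    distribution P Y A = (\int[lebesgue2]_(x in A `&` D) (xi x)%:E)%E.

End Sampling.

(* Main.v *)
(* Only the lower inequality is probabilistic: on E_K a Radon sample of f is at
   most B |c|_1, and the density bound forces Cu >= 1 / (4 K^2), so the upper
   inequality holds almost surely once C2 is large.  Independence of the shifted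
   projections yields Q points y_i of E_K with max_i |R f(y_i)| >= d |c|_1 for
   all c; by continuity this persists, with d / 2, on a small square box around
   each y_i.  If every box receives at least a quarter of its guaranteed expected
   number of samples, the empirical mean dominates a multiple of Cl |c|_1^2,
   hence the lower bound for C1 small.  A scalar Chernoff bound for each of the Q
   boxes gives failure probability at most Q exp(- n p / 4) with p proportional
   to Cl, and for C1 small the Bernstein exponent is below n p / 4 because
   gamma < 2 K C1 Cl / M2^2. *)

Require Import Defs.
From HB Require Import structures.
From mathcomp Require Import all_boot all_order all_algebra finmap.
From mathcomp Require Import all_classical all_reals all_analysis.
From mathcomp Require Import measurable_realfun ring lra.

Set Implicit Arguments.
Unset Strict Implicit.
Unset Printing Implicit Defensive.

Import Order.TTheory GRing.Theory Num.Theory.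
Import numFieldNormedType.Exports.

Local Open Scope classical_set_scope.
Local Open Scope ring_scope.

(** * Finitely many points determine a finite-dimensional function space *)

(** The points are chosen greedily. Fewer than [q] rows have a common nonzero kernel vector [u]; the
    hypothesis applied to [u] gives a point [x] of [D] whose row does not annihilate [u], so [v x]
    lies outside the span of the earlier rows. *)
Lemma row_free_sample (F : fieldType) (X : Type) (D : set X) (q : nat)
    (v : X -> 'rV[F]_q) :
  (forall c : 'cV[F]_q, (forall x, D x -> v x *m c = 0) -> c = 0) ->
  forall m, (m <= q)%N ->
  exists2 y : 'I_m -> X, (forall i, D (y i)) &
    row_free (\matrix_(i < m) v (y i)).
Proof.
move=> vD; elim=> [_|m IH mq].
  exists (fun i : 'I_0 => False_rect X (notF (valP i))); first by case.
  by rewrite /row_free; apply/eqP/anti_leq; rewrite rank_leq_row.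
have [y yD yfree] := IH (ltnW mq); set A := \matrix_i v (y i) in yfree.
have : ~~ row_free A^T.
  by rewrite -kermx_eq0 -mxrank_eq0 mxrank_ker mxrank_tr (eqP yfree) subn_eq0 -ltnNge.
rewrite -kermx_eq0 => /rowV0Pn[u /sub_kermxP uA u0].
have [x xD vxu] : exists2 x, D x & v x *m u^T != 0.
  apply: contrapT => H; move/eqP: u0; apply; apply: trmx_inj; rewrite trmx0.
  by apply: vD => x xD; apply/eqP/negPn/negP => vxu; apply: H; exists x.
(* Pairing a vanishing combination with [u] kills the rows of [A] and isolates the coefficient of
   [v x]. *)
have free_xA : row_free (col_mx (v x) A).
  apply: inj_row_free => w; rewrite -[w in w *m _]hsubmxK mul_row_col => /eqP.
  rewrite addr_eq0 => /eqP wE.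
  have Au : A *m u^T = 0 by apply: trmx_inj; rewrite trmx_mul trmxK uA trmx0.
  have l0 : lsubmx w = 0.
    have : lsubmx w *m (v x *m u^T) = 0.
      by rewrite mulmxA wE mulNmx -mulmxA Au mulmx0 oppr0.
    rewrite [v x *m u^T]mx11_scalar mul_mx_scalar => /eqP; rewrite scaler_eq0.
    case/orP => [/eqP z|/eqP //].
    by move: vxu; rewrite [v x *m u^T]mx11_scalar z raddf0 eqxx.
  suff r0 : rsubmx w = 0 by rewrite -[w]hsubmxK l0 r0 row_mx0.
  apply: (row_free_inj yfree); rewrite mul0mx; apply/eqP.
  by rewrite -oppr_eq0 -wE l0 mul0mx.
pose y' (i : 'I_(1 + m)) := match fintype.split i with inl _ => x | inr j => y j end.
exists y' => [i|]; first by rewrite /y'; case: fintype.split.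
rewrite (_ : \matrix_i v (y' i) = col_mx (v x) A)//.
apply/matrixP => i j; rewrite !mxE /y'; case: fintype.split => k; last by rewrite mxE.
by rewrite (ord1 k).
Qed.

(** Recovering [c] as [invmx A *m (A *m c)] bounds its l1 norm by [B] times the largest entry of
    [A *m c]. Using [B + 1] makes the constant invertible and the resulting contradiction strict;
    [0 < q] supplies an entry that forces the l1 norm to be positive. *)
Lemma unitmx_coercive (R : realType) (q : nat) (A : 'M[R]_q) :
  (0 < q)%N -> A \in unitmx ->
  exists2 dl : R, 0 < dl & forall c : 'cV[R]_q,
    exists i, dl * \sum_k `|c k 0| <= `|(A *m c) i 0|.
Proof.
move=> q0 uA; pose B := \sum_k \sum_i `|invmx A k i|.
have B0 : 0 <= B by rewrite sumr_ge0// => k _; rewrite sumr_ge0.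
have B1 : 0 < (B + 1)^-1 by rewrite invr_gt0 ltr_wpDl.
exists (B + 1)^-1 => // c; set s := \sum_k _.
apply: contrapT => H.
have Hlt i : `|(A *m c) i 0| < (B + 1)^-1 * s.
  by rewrite ltNge; apply/negP => ?; apply: H; exists i.
have s0 : 0 < s.
  have := le_lt_trans (normr_ge0 _) (Hlt (Ordinal q0)).
  by rewrite pmulr_rgt0.
suff : s <= B * ((B + 1)^-1 * s).
  rewrite leNgt mulrA gtr_pMl// ltr_pdivrMr ?ltr_wpDl// mul1r.
  by rewrite ltrDl ltr01.
rewrite {1}/s /B mulr_suml ler_sum// => k _; rewrite mulr_suml.
rewrite -{1}[c](mulKmx uA) mxE (le_trans (ler_norm_sum _ _ _))// ler_sum// => i _.
by rewrite normrM ler_wpM2l// ltW.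
Qed.

Lemma coercive_sample (R : realType) (X : Type) (I : eqType) (D : set X)
    (s : seq I) (g : I -> X -> R) :
  uniq s -> (0 < size s)%N ->
  (forall c : I -> R, (forall x, D x -> \sum_(k <- s) c k * g k x = 0) ->
    forall k, k \in s -> c k = 0) ->
  exists (dl : R) (y : 'I_(size s) -> X),
    [/\ 0 < dl, forall i, D (y i) & forall c : I -> R, exists i,
      dl * \sum_(k <- s) `|c k| <= `|\sum_(k <- s) c k * g k (y i)|].
Proof.
move=> us s0 gD; pose q := size s; pose t := in_tuple s.
pose v x : 'rV[R]_q := \row_k g (tnth t k) x.
have vE x (c : I -> R) : (v x *m \col_k c (tnth t k)) 0 0 = \sum_(k <- s) c k * g k x.
  by rewrite mxE [RHS]big_tnth; apply: eq_bigr => k _; rewrite !mxE mulrC.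
have [c vc|y yD yfree] := row_free_sample (D := D) (v := v) _ (leqnn q).
  (* A column vector becomes a coefficient function on [I]: since [s] is duplicate-free, [index]
     inverts [tnth t], and elements outside [s] get 0. *)
  pose c' (k : I) := if insub (index k s) is Some i then c i 0 else 0.
  have c'E i : c' (tnth t i) = c i 0.
    rewrite /c' (tnth_nth (tnth t i)) index_uniq//.
    by case: insubP => [j _ /val_inj ->//|]; rewrite ltn_ord.
  have cE : c = \col_k c' (tnth t k).
    by apply/colP => i; rewrite mxE c'E.
  apply/colP => i; rewrite -c'E mxE; apply: gD; last exact: mem_tnth.
  by move=> x Dx; rewrite -vE -cE vc// mxE.
have [dl dl0 H] := unitmx_coercive s0 (etrans (esym (row_free_unit _)) yfree).
exists dl, y; split => // c; have [i] := H (\col_k c (tnth t k)).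
move=> Hi; exists i.
have -> : \sum_(k <- s) `|c k| = \sum_k `|(\col_k c (tnth t k)) k 0|.
  by rewrite big_tnth; apply: eq_bigr => k _; rewrite mxE.
rewrite -vE (le_trans Hi)// le_eqVlt; apply/orP; left; apply/eqP.
by congr (`| _ |); rewrite !mxE; apply: eq_bigr => k _; rewrite !mxE.
Qed.

(** * A Chernoff bound for the number of hits *)

Lemma measure_bigsetU_le (R : realType) d (T : measurableType d)
    (mu : {measure set T -> \bar R}) (I : Type) (s : seq I) (Q : pred I)
    (F : I -> set T) :
  (forall i, measurable (F i)) ->
  (mu (\big[setU/set0]_(i <- s | Q i) F i) <= \sum_(i <- s | Q i) mu (F i))%E.
Proof.
move=> mF; elim: s => [|i s IH]; first by rewrite !big_nil measure0.
rewrite !big_cons; case: ifP => // _.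
rewrite (le_trans (measureU2 _ _ _))//; first exact: bigsetU_measurable.
by rewrite leeD2l.
Qed.

(* Chernoff: each term with #|S| < a is multiplied by expR (a - #|S|) >= 1, after
   which the sum over all S factors over j. *)
Lemma lower_tail_weight (R : realType) (n : nat) (p : 'I_n -> R) (b a : R) :
  0 <= b -> (forall j, b <= p j <= 1) ->
  \sum_(S : {set 'I_n} | #|S|%:R < a)
     \prod_(j < n) (if j \in S then p j else 1 - p j)
    <= expR (a - n%:R * b / 2).
Proof.
move=> b0 pb.
have p0 j : 0 <= p j <= 1 by have /andP[bp ->] := pb j; rewrite (le_trans b0).
(* This crude value gives each factor [1 - (1 - expR (-1)) * p j] the bound [1 - b / 2], hence
   [expR (- (b / 2))]. *)
have e2 : expR (-1) <= 2^-1 :> R.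
  rewrite expRN lef_pV2 ?posrE ?expR_gt0//.
  by rewrite (le_trans _ (expR_ge1Dx _)).
apply: (@le_trans _ _ (\sum_(S : {set 'I_n}) expR a *
    \prod_(j < n) (if j \in S then expR (-1) * p j else 1 - p j))).
  rewrite [leRHS](bigID (fun S : {set 'I_n} => #|S|%:R < a)) /=.
  rewrite ler_wpDr//.
    rewrite sumr_ge0// => S _; rewrite mulr_ge0 ?expR_ge0// prodr_ge0// => j _.
    have /andP[pj0 pj1] := p0 j.
    by case: ifP => _; rewrite ?mulr_ge0 ?expR_ge0 ?subr_ge0.
  apply: ler_sum => S Sa.
  have -> : \prod_(j < n) (if j \in S then expR (-1) * p j else 1 - p j) =
      expR (- #|S|%:R) * \prod_(j < n) (if j \in S then p j else 1 - p j).
    rewrite -(mulrN1 #|S|%:R) expRM_natl -prodr_const.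
    rewrite [X in _ = X * _]big_mkcond -big_split/=; apply: eq_bigr => j _.
    by case: ifP => _; rewrite ?mul1r.
  rewrite mulrA -expRD ler_peMl//.
    rewrite prodr_ge0// => j _; have /andP[pj0 pj1] := p0 j.
    by case: ifP => _; rewrite ?subr_ge0.
  by rewrite -[leLHS]expR0 ler_expR subr_ge0 ltW.
rewrite -big_distrr/= -bigA_distr/= expRD ler_wpM2l ?expR_ge0//.
apply: (@le_trans _ _ (\prod_(j < n) expR (- (b / 2)))).
  apply: ler_prod => j _; have /andP[pj0 pj1] := p0 j; have /andP[bp _] := pb j.
  apply/andP; split; first by rewrite addr_ge0 ?mulr_ge0 ?expR_ge0 ?subr_ge0.
  apply: le_trans (expR_ge1Dx _).
  have : expR (-1) * p j <= 2^-1 * p j by rewrite ler_wpM2r.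
  lra.
by rewrite prodr_const card_ord -expRM_natl mulrN mulrA.
Qed.

(** The event splits according to the exact set [S] of indices that hit [A]; independence makes each
    piece a product, and the weighted sum is bounded by [lower_tail_weight]. The threshold [n b / 4]
    is half of [n b / 2], so the exponent becomes minus the threshold. *)
Lemma independent_hits_lower_tail (R : realType) d (T : measurableType d)
    (P : probability T R) d' (T' : measurableType d') (n : nat)
    (X : 'I_n -> {RV P >-> T'}) (A : set T') (b : R) :
  mutually_independent X -> measurable A -> 0 <= b ->
  (forall j, b%:E <= P (X j @^-1` A))%E ->
  measurable [set w | #|[pred j | X j w \in A]|%:R < n%:R * b / 4] /\
  (P [set w | (#|[pred j | X j w \in A]|%:R < n%:R * b / 4)%R] <=
    (expR (- (n%:R * b / 4)))%:E)%E.
Proof.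
move=> indep mA b0 bP; set a := n%:R * b / 4.
pose E (S : {set 'I_n}) j := if j \in S then A else ~` A.
have mE S j : measurable (E S j) by rewrite /E; case: ifP => // _; exact: measurableC.
have mX j B : measurable B -> measurable (X j @^-1` B).
  by move=> mB; rewrite -[X in measurable X]setTI; exact: measurable_funP.
pose F S := \bigcap_j (X j @^-1` E S j).
have mF S : measurable (F S).
  by apply: fin_bigcap_measurable => // j _; exact: mX.
have -> : [set w | #|[pred j | X j w \in A]|%:R < a] =
    \big[setU/set0]_(S : {set 'I_n} | #|S|%:R < a) F S.
  rewrite -bigcup_seq_cond; apply/seteqP; split => w /= => [wa|[S /= /andP[_ Sa] SX]].
    exists (finset (fun j => X j w \in A)).
      by rewrite /= mem_index_enum cardsE.
    move=> j _; rewrite /preimage /E /= inE.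
    by case: ifPn => [/set_mem//|/negP H /mem_set].
  suff -> : #|[pred j | X j w \in A]| = #|S| by [].
  apply: eq_card => j; rewrite inE; have := SX j I; rewrite /preimage /E /=.
  by case: ifPn => [_ /mem_set//|_ H]; apply/negbTE/negP => /set_mem.
split; first exact: bigsetU_measurable.
pose p j := fine (P (X j @^-1` A)).
have pE j : P (X j @^-1` A) = (p j)%:E.
  by rewrite fineK// fin_num_measure//; exact: mX.
rewrite (le_trans (measure_bigsetU_le _ _ _ _))//.
have -> : - a = a - n%:R * b / 2 by rewrite /a; lra.
have pb j : b <= p j <= 1.
  by rewrite -!lee_fin -pE bP probability_le1//; exact: mX.
apply: (@le_trans _ _ (\sum_(S : {set 'I_n} | (#|S|%:R < a)%R)
    \prod_(j < n) (if j \in S then p j else 1 - p j))%:E); last first.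
  by rewrite lee_fin; exact: lower_tail_weight.
rewrite -sumEFin lee_sum// => S _.
rewrite [leLHS](indep (E S) (mE S)) -prodEFin le_eqVlt; apply/orP; left; apply/eqP.
apply: eq_bigr => j _; rewrite /E; case: ifP => // _.
by rewrite preimage_setC probability_setC ?pE//; exact: mX.
Qed.

(** * Measurability on the plane *)

(** The plane carries the product sigma-algebra, so openness alone does not give measurability; an
    open set is the union of the countably many rational open boxes that it contains. *)
Lemma open_plane_measurable (R : realType) (U : set (R * R)) :
  open U -> measurable (U : set (plane R)).
Proof.
move=> oU.
pose box (q : rat * rat * rat * rat) : set (R * R) :=
  `]ratr q.1.1.1, ratr q.1.1.2[ `*` `]ratr q.1.2, ratr q.2[.
have -> : U = \bigcup_q (if `[< box q `<=` U >] then box q else set0).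
  apply/seteqP; split => [[x1 x2] Ux|x [q _]]; last first.
    by case: asboolP => // + qx; exact.
  have /nbhs_ballP[e /= e0 eU] : nbhs (x1, x2) U by exact: open_nbhs_nbhs.
  have [a] := @rat_in_itvoo R (x1 - e) x1 ltac:(lra); rewrite in_itv/= => /andP[a1 a2].
  have [b] := @rat_in_itvoo R x1 (x1 + e) ltac:(lra); rewrite in_itv/= => /andP[b1 b2].
  have [c] := @rat_in_itvoo R (x2 - e) x2 ltac:(lra); rewrite in_itv/= => /andP[c1 c2].
  have [f] := @rat_in_itvoo R x2 (x2 + e) ltac:(lra); rewrite in_itv/= => /andP[f1 f2].
  exists (a, b, c, f) => //; case: asboolP => [_|[]].
    by rewrite /box; split; rewrite /= in_itv/=; apply/andP.
  move=> [y1 y2] [/=]; rewrite !in_itv/= => /andP[? ?] /andP[? ?].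
  by apply: eU; split; rewrite /ball/= ltr_norml; apply/andP; split; lra.
apply: countable_bigcupT_measurable; first exact: countableP.
move=> q; case: ifP => // _; apply: measurableX; exact: measurable_itv.
Qed.

Lemma continuous_plane_measurable (R : realType) (g : R * R -> R) :
  continuous g -> measurable_fun setT (g : plane R -> R).
Proof.
move=> cg; apply: (measurability _ (RGenOpens.measurableE R)).
move=> _ [_ [a [b ->] <-]]; rewrite setTI; apply: open_plane_measurable.
by move/continuousP : cg; apply; exact: interval_open.
Qed.

Lemma continuous_shift (R : realType) (g : R * R -> R) (a : R * R) :
  continuous g -> continuous (fun x : R * R => g (x - a)).
Proof.
move=> cg x; apply: continuous_comp; last exact: cg.
by apply: cvgB; [exact: cvg_id|exact: cvg_cst].
Qed.

Lemma square_compact (R : realType) (K : R) : compact (square K).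
Proof. by apply: compact_setX; exact: segment_compact. Qed.

Lemma square_measurable (R : realType) (K : R) : measurable (square K : set (plane R)).
Proof. by apply: measurableX; exact: measurable_itv. Qed.

Lemma lebesgue2X (R : realType) (A B : set (measurableTypeR R)) :
  measurable A -> measurable B ->
  lebesgue2 (A `*` B) = (lebesgue_measure A * lebesgue_measure B)%E.
Proof. exact: product_measure1E. Qed.

Lemma lebesgue2_itv (R : realType) (a1 b1 a2 b2 : R) : a1 <= b1 -> a2 <= b2 ->
  lebesgue2 (`[a1, b1] `*` `[a2, b2]) = ((b1 - a1) * (b2 - a2))%:E.
Proof.
move=> ab1 ab2; have len (a b : R) : a <= b ->
    lebesgue_measure (`[a, b] : set R) = (b - a)%:E.
  move=> ab; rewrite lebesgue_measure_itv/= lte_fin; case: ltgtP ab => // -> _.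
  by rewrite subrr.
by rewrite lebesgue2X ?len//; exact: measurable_itv.
Qed.

Lemma compact_norm_bound (R : realType) (T : topologicalType) (A : set T) (g : T -> R) :
  compact A -> continuous g -> exists2 B, 0 < B & forall x, A x -> `|g x| <= B.
Proof.
move=> cA cg.
have /compact_bounded[M [_ MB]] : compact (g @` A).
  by apply: continuous_compact => //; exact: continuous_subspaceT.
exists (`|M| + 1); first by rewrite ltr_wpDl.
move=> x Ax; apply: (MB (`|M| + 1)); last by exists x.
by rewrite (le_lt_trans (ler_norm _))// ltrDl.
Qed.

Lemma continuous_square_integrable (R : realType) (K : R) (g : R * R -> R) :
  0 < K -> continuous g ->
  lebesgue2.-integrable (square K : set (plane R)) (EFin \o g).
Proof.
move=> K0 cg; have [B _ gB] := compact_norm_bound (@square_compact R K) cg.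
apply: measurable_bounded_integrable.
- exact: square_measurable.
- by rewrite lebesgue2_itv ?ltry; lra.
- by apply: measurable_funTS; exact: continuous_plane_measurable.
- exists B; split; first exact: num_real.
  by move=> M BM x Kx; exact: (le_trans (gB _ Kx) (ltW BM)).
Qed.

(** * The Radon transform of shifted generators *)

Lemma Rintegral_linear_sum (R : realType) d (T : measurableType d)
    (mu : {measure set T -> \bar R}) (D : set T) (I : Type) (s : seq I)
    (c : I -> R) (g : I -> T -> R) :
  measurable D -> (forall k, mu.-integrable D (EFin \o g k)) ->
  \int[mu]_(x in D) (\sum_(k <- s) c k * g k x) =
    \sum_(k <- s) c k * \int[mu]_(x in D) g k x.
Proof.
move=> mD ig.
have igZ k : mu.-integrable D (EFin \o (fun x => c k * g k x)).
  by apply: (@eq_integrable _ _ _ _ _ mD _ _ _ (integrableZl mD (c k) (ig k))).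
elim: s => [|k s IH].
  by rewrite big_nil; under eq_Rintegral do rewrite big_nil; rewrite Rintegral_cst// mul0r.
rewrite big_cons -IH -RintegralZl//.
under eq_Rintegral do rewrite big_cons.
rewrite RintegralD//.
apply: (eq_integrable mD (fun x => \sum_(k <- s) (c k * g k x)%:E)%E).
  by move=> x _; rewrite sumEFin.
by apply: integrable_sum => // i _; exact: igZ.
Qed.

(** The pushforward of Lebesgue measure under a translation agrees with it on half-open intervals,
    hence everywhere by uniqueness; the claim is then the change of variables for a pushforward. *)
Lemma integral_translation (R : realType) (h : R -> R) (a : R) :
  (@lebesgue_measure R).-integrable setT (EFin \o h) ->
  \int[@lebesgue_measure R]_(s in setT) h (s - a) =
    \int[@lebesgue_measure R]_(s in setT) h s.
Proof.
move=> ih; pose f0 (s : measurableTypeR R) : measurableTypeR R := s + a.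
have mf0 : measurable_fun setT f0 by exact: measurable_funD.
pose mf0_mixin := isMeasurableFun.Build _ _ _ _ _ mf0.
pose f : {mfun _ >-> _} := HB.pack f0 mf0_mixin.
have lebf A : measurable A -> pushforward lebesgue_measure f A = lebesgue_measure A.
  move=> mA; apply/esym/lebesgue_measure_unique => //= _ [[u v]] _ <-.
  rewrite /pushforward.
  have -> : f0 @^-1` [set` `]u, v]] = [set` `]u - a, v - a]].
    by apply/seteqP; split=> x /=; rewrite /f0 !in_itv/= => /andP[? ?]; apply/andP; split; lra.
  rewrite !lebesgue_measure_itv/= !lte_fin ltrD2r; case: ifP => // _.
  by rewrite -!EFinD; congr EFin; lra.
have hK : (EFin \o (fun s => h (s - a))) \o f0 = EFin \o h.
  by apply/funext => s; rewrite /= /f0 addrK.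
have mh : measurable_fun (setT : set (measurableTypeR R)) (fun s : R => h (s - a)).
  apply: measurableT_comp; last exact: measurable_funB.
  by apply/measurable_EFinP; exact: (measurable_int _ ih).
congr fine; transitivity (\int[pushforward lebesgue_measure f]_s (h (s - a))%:E)%E.
  by apply: eq_measure_integral => A mA _; apply: esym; exact: lebf.
rewrite integral_pushforward//.
- by rewrite preimage_setT; apply: eq_integral => s _; rewrite /= /f0 addrK.
- exact/measurable_EFinP.
- by rewrite preimage_setT; exact: (eq_ind_r (integrable _ _) ih hK).
Qed.

Section RadonOfCompactlySupported.
Context {R : realType} (N theta : R) (phi : R * R -> R).
Hypotheses (cphi : continuous phi) (sphi : forall x, phi x != 0 -> square N x).
Implicit Types (t s : R).

Let pt t s : R * R := (t * cos theta - s * sin theta, t * sin theta + s * cos theta).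

Let affine_continuous (a b c d : R) : continuous (fun u : R => (u * a + b, u * c + d)).
Proof.
have affine1 (v w : R) : continuous (fun u : R => u * v + w).
  by move=> u; apply: (@cvgD _ R^o); [apply: cvgMr_tmp; exact: cvg_id|exact: cvg_cst].
by move=> u; apply: (@cvg_pair _ _ _ (nbhs u) (nbhs _) (nbhs _)); exact: affine1.
Qed.

Let pt_continuous_t s : continuous (pt^~ s).
Proof. exact: affine_continuous. Qed.

Let pt_continuous_s t : continuous (pt t).
Proof.
have -> : pt t = (fun s => (s * - sin theta + t * cos theta, s * cos theta + t * sin theta)).
  by apply/funext => s; rewrite /pt; congr pair; ring.
exact: affine_continuous.
Qed.

(** The parameter [s] is the coordinate of [pt t s] along [(- sin theta, cos theta)], which is at
    most [2 * N] in absolute value on the square. The bound is uniform in [t], so all line integrals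
    live on one compact interval. *)
Let phi_pt_out t s : s \notin `[- (2 * N), 2 * N] -> phi (pt t s) = 0.
Proof.
move=> sN; apply/eqP; apply: contraNT sN => /sphi.
rewrite /square /pt /= !in_itv/= => -[/andP[a1 a2] /andP[b1 b2]].
have e : s = (t * sin theta + s * cos theta) * cos theta
    - (t * cos theta - s * sin theta) * sin theta.
  by rewrite -[LHS]mulr1 -(cos2Dsin2 theta); ring.
have bound (x v : R) : - N <= x -> x <= N -> `|v| <= 1 -> `|x * v| <= N.
  move=> Nx xN v1; rewrite normrM -[leRHS]mulr1 ler_pM// ler_norml.
  by rewrite Nx.
have := bound _ _ b1 b2 (cos_max theta); have := bound _ _ a1 a2 (sin_max theta).
rewrite !ler_norml => /andP[c1 c2] /andP[d1 d2].
by rewrite e; apply/andP; split; lra.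
Qed.

Let phi_ptE t : (fun s => phi (pt t s)) = (fun s => phi (pt t s)) \_ `[- (2 * N), 2 * N].
Proof.
apply/funext => s; rewrite patchE; case: ifPn => // sN; apply: phi_pt_out.
by apply: contraNN sN => ?; rewrite inE.
Qed.

Let phi_pt_continuous t : continuous (fun s => phi (pt t s)).
Proof. by move=> s; apply: continuous_comp; [exact: pt_continuous_s|exact: cphi]. Qed.

Let phi_pt_integrable_itv t :
  (@lebesgue_measure R).-integrable `[- (2 * N), 2 * N] (EFin \o (fun s => phi (pt t s))).
Proof.
apply: continuous_compact_integrable; first exact: segment_compact.
exact/continuous_subspaceT/phi_pt_continuous.
Qed.

Let phi_pt_integrable t :
  (@lebesgue_measure R).-integrable setT (EFin \o (fun s => phi (pt t s))).
Proof.
rewrite phi_ptE -restrict_EFin.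
have [+ _] := integrable_mkcond (mu := lebesgue_measure)
  (EFin \o (fun s => phi (pt t s))) (measurable_itv `[- (2 * N), 2 * N]).
by apply; exact: phi_pt_integrable_itv.
Qed.

Let radonE t : radon theta phi t =
  \int[@lebesgue_measure R]_(s in `[- (2 * N), 2 * N]) phi (pt t s).
Proof. by rewrite Rintegral_mkcond -phi_ptE. Qed.

Lemma radon_integrable t :
  (@lebesgue_measure R).-integrable setT
    (EFin \o (fun s => phi (t * cos theta - s * sin theta, t * sin theta + s * cos theta))).
Proof. exact: phi_pt_integrable. Qed.

(** Dominated convergence on the common interval [[- (2 * N), 2 * N]], with a constant bound of
    [phi] as dominating function; the window of radius 1 around [t] is arbitrary. *)
Lemma radon_continuous : continuous (radon theta phi).
Proof.
move=> t; rewrite (funext radonE : radon theta phi = _).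
have [B B0 phiB] := compact_norm_bound (@square_compact R N) cphi.
have phi_le x : `|phi x| <= B.
  by have [->|/sphi/phiB//] := eqVneq (phi x) 0; rewrite normr0 ltW.
apply: (@continuity_under_integral R _ _ lebesgue_measure (fun t s => phi (pt t s))
  `[- (2 * N), 2 * N] (measurable_itv _) (t - 1) (t + 1) _ _ (cst B)).
- by move=> x _; exact: phi_pt_integrable_itv.
- apply: aeW => s _ x _; apply: continuous_comp; [exact: pt_continuous_t|exact: cphi].
- apply: continuous_compact_integrable; first exact: segment_compact.
  by apply: continuous_subspaceT => x; exact: cvg_cst.
- by move=> x _; apply: aeW => s _; exact: phi_le.
- by rewrite inE/= in_itv/=; apply/andP; split; lra.
Qed.

(** In the rotated frame, subtracting [a] lowers [t] by the component of [a] along the direction and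
    [s] by its component along the line; the second change disappears by translation invariance. *)
Lemma radon_shift t (a : R * R) :
  radon theta (fun x => phi (x - a)) t = radon theta phi (t - dotp (direction theta) a).
Proof.
rewrite /radon -[RHS](integral_translation (a.2 * cos theta - a.1 * sin theta)); last first.
  exact: phi_pt_integrable.
apply: eq_Rintegral => s _; congr phi; case: a => a1 a2.
have pE (x : R) : x = x * cos theta ^+ 2 + x * sin theta ^+ 2.
  by rewrite -mulrDr cos2Dsin2 mulr1.
rewrite /dotp /direction/=; congr pair => /=.
  by rewrite [in LHS](pE a1); ring.
by rewrite [in LHS](pE a2); ring.
Qed.

End RadonOfCompactlySupported.

Lemma radon_at_shift_comb (R : realType) (N K theta : R) (phi : R * R -> R)
    (c : int * int -> R) (x : R * R) :
  continuous phi -> supp phi `<=` square N ->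
  radon_at theta (shift_comb N K phi c) x = \sum_(k <- lattice_index N K)
    c k * radon theta phi (dotp (direction theta) x - dotp (direction theta) (lattice_pt k)).
Proof.
move=> cphi sphi.
have phi_out y : phi y != 0 -> square N y.
  by move=> y0; apply: sphi; exact: (@subset_closure _ [set z | phi z != 0]).
rewrite /radon_at [LHS]Rintegral_linear_sum//; last first.
  move=> k; move: (lattice_pt k) => [a1 a2].
  (* The shifted generator is no longer supported in [square N], only in this larger square. *)
  apply: (@radon_integrable _ (N + `|a1| + `|a2|) _ (fun y => phi (y - (a1, a2)))).
  - exact: continuous_shift.
  - move=> [y1 y2] /phi_out; rewrite /square/= !in_itv/= => -[/andP[? ?] /andP[? ?]].
    have := ler_norm a1; have := ler_norm a2; have := ler_norm (- a1); have := ler_norm (- a2).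
    rewrite !normrN => *.
    by have := normr_ge0 a1; have := normr_ge0 a2; split; apply/andP; split; lra.
apply: eq_bigr => k _; congr (_ * _).
by rewrite -(radon_shift _ cphi phi_out).
Qed.

(** * Quadratic forms and measurability of the sampling event *)

(** All three members of the sampling inequality have this form in the coefficients, so the
    inequality for all [f] becomes nonnegativity of two forms. The nesting lets linearity of the
    integral be applied one sum at a time. *)
Definition quadratic_form (R : pzRingType) (I : Type) (s : seq I)
    (a : I -> I -> R) (c : I -> R) : R :=
  \sum_(k <- s) c k * \sum_(l <- s) c l * a k l.

Lemma quadratic_form_rank1 (R : comPzRingType) (I : Type) (s : seq I) (c u : I -> R) :
  (\sum_(k <- s) c k * u k) ^+ 2 = quadratic_form s (fun k l => u k * u l) c.
Proof.
rewrite /quadratic_form expr2 mulr_suml; apply: eq_bigr => k _.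
rewrite -mulrA; congr (_ * _); rewrite mulr_sumr; apply: eq_bigr => l _.
by rewrite mulrCA.
Qed.

Lemma quadratic_form_sum (R : comPzRingType) (I J : Type) (s : seq I) (r : seq J)
    (a : J -> I -> I -> R) (c : I -> R) :
  \sum_(j <- r) quadratic_form s (a j) c =
    quadratic_form s (fun k l => \sum_(j <- r) a j k l) c.
Proof.
rewrite /quadratic_form exchange_big; apply: eq_bigr => k _.
rewrite -mulr_sumr; congr (_ * _); rewrite exchange_big; apply: eq_bigr => l _.
by rewrite mulr_sumr.
Qed.

Lemma quadratic_formZ (R : comPzRingType) (I : Type) (s : seq I)
    (a : I -> I -> R) (x : R) (c : I -> R) :
  x * quadratic_form s a c = quadratic_form s (fun k l => x * a k l) c.
Proof.
rewrite /quadratic_form mulr_sumr; apply: eq_bigr => k _.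
rewrite mulrCA; congr (_ * _); rewrite mulr_sumr; apply: eq_bigr => l _.
by rewrite mulrCA.
Qed.

Lemma quadratic_formB (R : comPzRingType) (I : Type) (s : seq I)
    (a b : I -> I -> R) (c : I -> R) :
  quadratic_form s a c - quadratic_form s b c =
    quadratic_form s (fun k l => a k l - b k l) c.
Proof.
rewrite /quadratic_form -sumrB; apply: eq_bigr => k _.
rewrite -mulrBr; congr (_ * _); rewrite -sumrB; apply: eq_bigr => l _.
by rewrite -mulrBr.
Qed.

Lemma cvg_sumr (R : realType) (U : Type) (F : set_system U) {FF : Filter F}
    (J : Type) (r : seq J) (f : U -> J -> R) (a : J -> R) :
  (forall j, f x j @[x --> F] --> a j) ->
  \sum_(j <- r) f x j @[x --> F] --> \sum_(j <- r) a j.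
Proof.
move=> fa; elim: r => [|j r IH].
  by rewrite big_nil; under eq_fun do rewrite big_nil; exact: cvg_cst.
by rewrite big_cons; under eq_fun do rewrite big_cons; exact: cvgD.
Qed.

(** The form is continuous in the finitely many relevant coefficients, and rational vectors are
    dense. Vectors are coded as lists of rationals read through [index], which makes the family of
    tests countable. *)
Lemma quadratic_form_ge0_rat (R : realType) (I : eqType) (s : seq I) (a : I -> I -> R) :
  (forall q : seq rat,
     0 <= quadratic_form s a (fun k => ratr (nth 0 q (index k s)))) ->
  forall c, 0 <= quadratic_form s a c.
Proof.
move=> rat_ge0 c.
have /choice[r rP] : forall kn : I * nat, exists q : rat,
    c kn.1 < ratr q < c kn.1 + kn.2.+1%:R^-1.
  move=> [k n]; have [|q] := @rat_in_itvoo R (c k) (c k + n.+1%:R^-1).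
    by rewrite ltrDl invr_gt0.
  by rewrite in_itv/= => ?; exists q.
have cvg_r k : ratr (r (k, n)) @[n --> \oo] --> c k.
  apply: (@squeeze_cvgr _ _ _ _ (cst (c k)) (fun n => c k + n.+1%:R^-1)).
  - by apply: nearW => n; have /andP[/ltW -> /ltW ->] := rP (k, n).
  - exact: cvg_cst.
  - rewrite -[X in _ --> X]addr0; apply: cvgD; [exact: cvg_cst|exact: cvg_harmonic].
have cvg_q : quadratic_form s a (fun k => ratr (r (k, n))) @[n --> \oo] -->
    quadratic_form s a c.
  apply: cvg_sumr => k; apply: cvgM; first exact: cvg_r.
  by apply: cvg_sumr => l; apply: cvgMr_tmp; exact: cvg_r.
apply: (cvgr_to_ge cvg_q); apply: nearW => n.
have := rat_ge0 [seq r (k, n) | k <- s].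
suff -> : quadratic_form s a (fun k => ratr (r (k, n))) =
  quadratic_form s a (fun k => ratr (nth 0 [seq r (k0, n) | k0 <- s] (index k s))) by [].
have rE k : k \in s -> nth 0 [seq r (k0, n) | k0 <- s] (index k s) = r (k, n).
  by move=> ks; rewrite (nth_map k) ?index_mem// nth_index.
apply: eq_big_seq => k ks; rewrite rE//; congr (_ * _).
by apply: eq_big_seq => l ls; rewrite rE.
Qed.

(* Positivity need only be tested on rational coefficients, which makes the
   intersection over all coefficients countable. *)
Lemma measurable_quadratic_form_ge0 (R : realType) d (T : measurableType d)
    (I : eqType) (s : seq I) (a : T -> I -> I -> R) :
  (forall k l, measurable_fun setT (fun w => a w k l)) ->
  measurable [set w | forall c, 0 <= quadratic_form s (a w) c].
Proof.
move=> ma; pose c (q : seq rat) (k : I) : R := ratr (nth 0 q (index k s)).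
have -> : [set w | forall c, 0 <= quadratic_form s (a w) c] =
    \bigcap_q ((fun w => quadratic_form s (a w) (c q)) @^-1` `[0, +oo[).
  apply/seteqP; split=> w /= H.
    by move=> q _; rewrite /= in_itv/= H.
  apply: quadratic_form_ge0_rat => q.
  by have := H q Logic.I; rewrite /= in_itv/= andbT.
rewrite -[X in measurable X]setCK setC_bigcap; apply: measurableC.
apply: countable_bigcupT_measurable; first exact: countableP.
move=> q; apply: measurableC; rewrite -[X in measurable X]setTI.
have mq : measurable_fun setT (fun w => quadratic_form s (a w) (c q)).
  apply: measurable_sum => k; apply: measurable_funM; first exact: measurable_cst.
  apply: measurable_sum => l; apply: measurable_funM; first exact: measurable_cst.
  exact: ma.
by apply: mq => //; exact: measurable_itv.
Qed.

(** The entries are those of the Gram matrix of the shifts on the square. *)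
Lemma L2norm_shift_comb_sqr (R : realType) (N K : R) (phi : R * R -> R)
    (c : int * int -> R) :
  0 < K -> continuous phi ->
  L2norm (square K) (shift_comb N K phi c) ^+ 2 =
    quadratic_form (lattice_index N K)
      (fun k l => \int[lebesgue2]_(x in square K)
        (phi (x - lattice_pt k) * phi (x - lattice_pt l))) c.
Proof.
move=> K0 cphi.
have cphi2 k l : continuous (fun x : R * R => phi (x - lattice_pt k) * phi (x - lattice_pt l)).
  by move=> x; apply: cvgM; exact: continuous_shift.
rewrite sqr_sqrtr; last by apply: Rintegral_ge0 => x _; rewrite sqr_ge0.
under eq_Rintegral do rewrite real_normK ?num_real// quadratic_form_rank1.
rewrite [LHS]Rintegral_linear_sum; [|exact: square_measurable|].
  apply: eq_bigr => k _; congr (_ * _); rewrite Rintegral_linear_sum//.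
    exact: square_measurable.
  by move=> l; apply: continuous_square_integrable.
move=> k; apply: continuous_square_integrable => //.
by move=> x; apply: cvg_sumr => l; apply: cvgMl_tmp; exact: cphi2.
Qed.

(** The event quantifies over uncountably many [f]. Comparing the empirical form [S w] with
    multiples of the Gram form [G] writes it as two nonnegativity events for forms with measurable
    entries. *)
Lemma measurable_sampling_event (R : realType) (N K theta : R) (phi : R * R -> R)
    d (T : measurableType d) (P : probability T R) (n : nat)
    (X : 'I_n -> {RV P >-> plane R}) (lo hi : R) :
  0 < K -> continuous phi -> supp phi `<=` square N ->
  measurable [set w | forall f, signal_space N K phi f ->
    lo * L2norm (square K) f ^+ 2
      <= n%:R^-1 * \sum_(j < n) `|radon_at theta f (X j w)| ^+ 2
      <= hi * L2norm (square K) f ^+ 2].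
Proof.
move=> K0 cphi sphi.
pose s := lattice_index N K.
pose G k l := \int[lebesgue2]_(x in square K)
  (phi (x - lattice_pt k) * phi (x - lattice_pt l)).
pose g k x := radon theta phi (dotp (direction theta) x
  - dotp (direction theta) (lattice_pt k)).
pose S w k l := n%:R^-1 * \sum_(j < n) (g k (X j w) * g l (X j w)).
have empE w c : n%:R^-1 * \sum_(j < n) `|radon_at theta (shift_comb N K phi c) (X j w)| ^+ 2
    = quadratic_form s (S w) c.
  rewrite -quadratic_formZ -quadratic_form_sum; congr (_ * _); apply: eq_bigr => j _.
  rewrite real_normK ?num_real// (radon_at_shift_comb _ _ _ _ cphi sphi).
  by rewrite quadratic_form_rank1.
have phi_out x : phi x != 0 -> square N x.
  by move=> x0; apply: sphi; exact: (@subset_closure _ [set z | phi z != 0]).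
have mS k l : measurable_fun setT (fun w => S w k l).
  have mg k' j : measurable_fun setT (fun w => g k' (X j w)).
    apply: (@measurableT_comp _ _ _ _ _ _ (radon theta phi)).
      by apply: continuous_measurable_fun; exact: (radon_continuous cphi phi_out).
    apply: measurable_funB; last exact: measurable_cst.
    have mX : measurable_fun setT (X j) by exact: measurable_funP.
    apply: measurable_funD; apply: measurable_funM; try exact: measurable_cst.
      exact: (measurableT_comp measurable_fst mX).
    exact: (measurableT_comp measurable_snd mX).
  apply: measurable_funM; first exact: measurable_cst.
  by apply: measurable_sum => j; exact: measurable_funM.
have -> : [set w | forall f, signal_space N K phi f ->
    lo * L2norm (square K) f ^+ 2
      <= n%:R^-1 * \sum_(j < n) `|radon_at theta f (X j w)| ^+ 2
      <= hi * L2norm (square K) f ^+ 2] =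
    [set w | forall c, 0 <= quadratic_form s (fun k l => S w k l - lo * G k l) c] `&`
    [set w | forall c, 0 <= quadratic_form s (fun k l => hi * G k l - S w k l) c].
  apply/seteqP; split => w /=.
    move=> H; split=> c; have /H : signal_space N K phi (shift_comb N K phi c) by exists c.
      rewrite empE L2norm_shift_comb_sqr// => /andP[+ _].
      by rewrite -quadratic_formB -(quadratic_formZ s G) subr_ge0.
    rewrite empE L2norm_shift_comb_sqr// => /andP[_].
    by rewrite -quadratic_formB -(quadratic_formZ s G) subr_ge0.
  move=> [Hlo Hhi] _ [c ->]; have := Hlo c; have := Hhi c.
  rewrite empE L2norm_shift_comb_sqr// -!quadratic_formB -!(quadratic_formZ s G).
  by rewrite !subr_ge0 => -> ->.
apply: measurableI; apply: measurable_quadratic_form_ge0 => k l.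
  by apply: measurable_funB; [exact: mS|exact: measurable_cst].
by apply: measurable_funB; [exact: measurable_cst|exact: mS].
Qed.

(** * Sample boxes *)

Lemma norm_sum_mul_le (R : realDomainType) (I : eqType) (s : seq I) (c u : I -> R) :
  `|\sum_(k <- s) c k * u k| <= (\sum_(k <- s) `|c k|) * \sum_(k <- s) `|u k|.
Proof.
rewrite (le_trans (ler_norm_sum _ _ _))// mulr_suml big_seq [leRHS]big_seq.
apply: ler_sum => k ks; rewrite normrM ler_wpM2l// (big_rem k)//= lerDl.
by rewrite sumr_ge0.
Qed.

Lemma sum_sqr_le_sqr_l1 (R : realDomainType) (I : eqType) (s : seq I) (c : I -> R) :
  \sum_(k <- s) c k ^+ 2 <= (\sum_(k <- s) `|c k|) ^+ 2.
Proof.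
rewrite expr2 mulr_suml big_seq [leRHS]big_seq.
apply: ler_sum => k ks; rewrite -real_normK ?num_real// expr2 ler_wpM2l//.
by rewrite (big_rem k)//= lerDl sumr_ge0.
Qed.

(** Cauchy-Schwarz against the constant vector, obtained by summing
    [2 |c k| |c l| <= c k ^+ 2 + c l ^+ 2] over all pairs. *)
Lemma sqr_l1_le_sum_sqr (R : realFieldType) (I : eqType) (s : seq I) (c : I -> R) :
  (\sum_(k <- s) `|c k|) ^+ 2 <= (size s)%:R * \sum_(k <- s) c k ^+ 2.
Proof.
have sum_const (x : R) : \sum_(k <- s) x = (size s)%:R * x.
  by rewrite big_const_seq count_predT iter_addr_0 mulr_natl.
have twice : 2 * ((size s)%:R * \sum_(k <- s) c k ^+ 2) =
    \sum_(k <- s) \sum_(l <- s) (c k ^+ 2 + c l ^+ 2).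
  under [RHS]eq_bigr do rewrite big_split/= sum_const.
  by rewrite big_split/= sum_const -mulr_sumr; ring.
rewrite -(ler_pM2l (ltr0Sn R 1)) twice expr2 mulr_suml mulr_sumr.
apply: ler_sum => k _; rewrite !mulr_sumr; apply: ler_sum => l _.
rewrite -(real_normK (num_real (c k))) -(real_normK (num_real (c l))) -subr_ge0.
have -> : `|c k| ^+ 2 + `|c l| ^+ 2 - 2 * (`|c k| * `|c l|) = (`|c k| - `|c l|) ^+ 2 by ring.
exact: sqr_ge0.
Qed.

Lemma finite_pos_lower_bound (R : realType) (n : nat) (r : 'I_n -> R) :
  (forall i, 0 < r i) -> exists2 e, 0 < e & forall i, e <= r i.
Proof.
move=> r0; exists (\big[Num.min/1]_i r i); last by move=> i; exact: bigmin_le_cond.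
by rewrite lt_bigmin// => i _; exact: r0.
Qed.

(** The interval extends from [x] towards the centre, so it stays inside even when [x] is an
    endpoint. *)
Lemma interval_in_itv (R : realType) (K e x : R) :
  0 < e -> e <= K -> - K <= x <= K ->
  exists b, [/\ - K <= b, b + e <= K & b <= x <= b + e].
Proof.
move=> e0 eK /andP[Kx xK]; have [x0|x0] := leP x 0.
  by exists x; split => //; [lra|apply/andP; split; lra].
by exists (x - e); split => //; [lra|lra|apply/andP; split; lra].
Qed.

(** The parameter [b] is the lower left corner, not the centre: a box around a boundary point of the
    square must lie to one side of it. *)
Definition box (R : realType) (e : R) (b : R * R) : set (R * R) :=
  `[b.1, b.1 + e] `*` `[b.2, b.2 + e].

Lemma coercive_boxes (R : realType) (I : eqType) (K : R) (s : seq I)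
    (g : I -> R * R -> R) :
  0 < K -> uniq s -> (0 < size s)%N -> (forall k, continuous (g k)) ->
  (forall c, (forall x, square K x -> \sum_(k <- s) c k * g k x = 0) ->
    forall k, k \in s -> c k = 0) ->
  exists (e dl : R) (b : 'I_(size s) -> R * R),
    [/\ 0 < e, 0 < dl, forall i, box e (b i) `<=` square K &
      forall c, exists i, forall x, box e (b i) x ->
        dl * \sum_(k <- s) `|c k| <= `|\sum_(k <- s) c k * g k x| ].
Proof.
move=> K0 us s0 cg gD.
have [dl [y [dl0 yK H]]] := coercive_sample us s0 gD.
(* Moving from [y i] to [x] changes the combination by at most the l1 norm of [c] times [F i x], so
   a single radius works for all [c] and costs half of [dl]. *)
pose F i (x : R * R) := \sum_(k <- s) `|g k x - g k (y i)|.
have /choice[r /all_and2[r0 rF]] i : exists r, 0 < r /\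
    forall x, ball (y i) r x -> F i x <= dl / 2.
  have : F i x @[x --> y i] --> 0.
    have -> : 0 = \sum_(k <- s) `|g k (y i) - g k (y i)|.
      by rewrite big1// => k _; rewrite subrr normr0.
    apply: cvg_sumr => k; apply: (@cvg_norm _ R^o); apply: (@cvgB _ R^o).
      exact: cg.
    exact: cvg_cst.
  move/cvgr_le => /(_ (dl / 2)); rewrite divr_gt0// => /(_ isT) /nbhs_ballP[r r0 Hr].
  by exists r; split => // x; exact: Hr.
have [e' e'0 e'r] := finite_pos_lower_bound r0.
(* The factor [e'] keeps each box strictly inside the ball around its point; [K] makes it fit in the
   square. *)
pose e := Num.min e' K / 2.
have e0 : 0 < e by rewrite divr_gt0// lt_min e'0.
have eK : e <= K.
  have : Num.min e' K <= K by rewrite ge_min lexx orbT.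
  by rewrite /e; lra.
have er i : e < r i.
  have : Num.min e' K <= e' by rewrite ge_min lexx.
  by have := e'r i; move: e0; rewrite /e; lra.
have /choice[b bP] i : exists b : R * R, box e b `<=` square K /\
    forall x, box e b x -> ball (y i) (r i) x.
  have := yK i; rewrite /square/= !in_itv/= => -[].
  move=> /(interval_in_itv e0 eK)[b1 [b11 b12 /andP[? ?]]].
  move=> /(interval_in_itv e0 eK)[b2 [b21 b22 /andP[? ?]]].
  exists (b1, b2); split=> [[x1 x2]|[x1 x2]]; rewrite /box/square/= !in_itv/=.
    by move=> [/andP[? ?] /andP[? ?]]; split; apply/andP; split; lra.
  have := er i => ? [/andP[? ?] /andP[? ?]].
  by split; rewrite /ball/= ltr_norml; apply/andP; split; lra.
exists e, (dl / 2), b; split => //; first by rewrite divr_gt0.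
  by move=> i; have [] := bP i.
move=> c; have [i Hi] := H c; exists i => x /(bP i).2 /rF Fx.
have : `|\sum_(k <- s) c k * g k (y i)| <=
    `|\sum_(k <- s) c k * g k x| + (\sum_(k <- s) `|c k|) * F i x.
  rewrite -lerBlDl (le_trans (lerB_dist _ _))// distrC -sumrB.
  under eq_bigr do rewrite -mulrBr.
  exact: norm_sum_mul_le.
have : (\sum_(k <- s) `|c k|) * F i x <= (\sum_(k <- s) `|c k|) * (dl / 2).
  by rewrite ler_wpM2l// sumr_ge0.
lra.
Qed.

(** * Laws with a density bounded above and below on the square *)

Section Density.
Context {R : realType} d (T : measurableType d) (P : probability T R).
Variables (K : R) (xi : R * R -> R) (Cl Cu : R) (Y : {RV P >-> plane R}).
Hypotheses (K0 : 0 < K) (Cl0 : 0 < Cl).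
Hypotheses (xiP : forall x, square K x -> Cl <= xi x <= Cu).
Hypotheses (Yxi : has_density_on (square K) xi Y).

Lemma density_outside : P (Y @^-1` (~` square K)) = 0%E.
Proof.
have [_ H] := Yxi; have := H (~` square K : set (plane R)).
rewrite /distribution /pushforward setICl integral_set0; apply.
by apply: measurableC; exact: square_measurable.
Qed.

Lemma density_bounds (A : set (plane R)) : measurable A -> A `<=` square K ->
  (Cl%:E * lebesgue2 A <= P (Y @^-1` A) <= Cu%:E * lebesgue2 A)%E.
Proof.
move=> mA AK; have [mxi H] := Yxi; have := H A mA.
rewrite /distribution /pushforward => ->; rewrite (setIidl AK).
have mxiA : measurable_fun A (EFin \o xi).
  by apply/measurable_EFinP; apply: measurable_funS mxi => //; exact: square_measurable.
rewrite -!integral_cst//; apply/andP; split; apply: ge0_le_integral => //.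
- by move=> x _; rewrite lee_fin ltW.
- by move=> x /AK/xiP/andP[Clx _]; rewrite lee_fin.
- by move=> x /AK/xiP/andP[Clx _]; rewrite lee_fin (le_trans (ltW Cl0)).
- by move=> x /AK/xiP/andP[_ ?]; rewrite lee_fin.
Qed.

Lemma density_box e b : 0 < e -> box e b `<=` square K ->
  ((Cl * e ^+ 2)%:E <= P (Y @^-1` box e b))%E.
Proof.
move=> e0 bK; have mb : measurable (box e b : set (plane R)).
  by apply: measurableX; exact: measurable_itv.
have /andP[+ _] := density_bounds mb bK.
rewrite /box lebesgue2_itv; [|lra|lra]; rewrite -EFinM.
by congr (_%:E <= _)%E; ring.
Qed.

(** The total mass 1 sits on a square of area [4 * K ^+ 2]. This lower bound on [Cu] lets the upper
    sampling constant be fixed before the density is known. *)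
Lemma density_sup_ge : 1 <= 4 * K ^+ 2 * Cu.
Proof.
have /andP[_] := density_bounds (square_measurable _) (@subset_refl _ (square K)).
have -> : P (Y @^-1` square K) = 1%E.
  rewrite -[square K]setCK preimage_setC probability_setC; last first.
    have mC : measurable (~` square K : set (plane R)).
      by apply: measurableC; exact: square_measurable.
    exact: (measurable_funPTI Y mC).
  by rewrite [X in (_ - X)%E]density_outside sube0.
have KK : - K <= K by move: K0; lra.
rewrite {1}/square lebesgue2_itv// -EFinM lee_fin.
by congr (_ <= _); ring.
Qed.

End Density.

(** Union bound: outside [E], either some sample leaves the square, which has probability zero, or
    one of the [q] boxes is hit too rarely. Any event that holds deterministically once all boxes
    are well hit is covered. *)
Lemma sampling_probability (R : realType) (K : R) (xi : R * R -> R) (Cl Cu : R)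
    (n : nat) d (T : measurableType d) (P : probability T R)
    (X : 'I_n -> {RV P >-> plane R}) (q : nat) (e : R) (b : 'I_q -> R * R) (E : set T) :
  0 < K -> 0 < Cl -> (forall x, square K x -> Cl <= xi x <= Cu) ->
  mutually_independent X -> (forall j, has_density_on (square K) xi (X j)) ->
  0 < e -> (forall i, box e (b i) `<=` square K) ->
  measurable E ->
  (forall w, (forall j, square K (X j w)) ->
    (forall i, n%:R * (Cl * e ^+ 2) / 4 <= #|[pred j | X j w \in box e (b i)]|%:R) ->
    E w) ->
  ((1 - q%:R * expR (- (n%:R * (Cl * e ^+ 2) / 4)))%:E <= P E)%E.
Proof.
move=> K0 Cl0 xiP indep Xxi e0 bK mE HE.
set p := Cl * e ^+ 2 in HE *; set ex := expR _.
have p0 : 0 <= p by rewrite mulr_ge0 ?sqr_ge0// ltW.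
pose few i := [set w | #|[pred j | X j w \in box e (b i)]|%:R < n%:R * p / 4].
have mbox i : measurable (box e (b i) : set (plane R)).
  by apply: measurableX; exact: measurable_itv.
have few_le i : measurable (few i) /\ (P (few i) <= ex%:E)%E.
  apply: independent_hits_lower_tail => // j.
  exact: (density_box Cl0 xiP (Xxi j) e0 (bK i)).
pose out j := X j @^-1` (~` square K).
have mout j : measurable (out j).
  have mC : measurable (~` square K : set (plane R)).
    by apply: measurableC; exact: square_measurable.
  exact: measurable_funPTI.
have EC : ~` E `<=` (\big[setU/set0]_(j < n) out j) `|` \big[setU/set0]_(i < q) few i.
  move=> w nE; apply: contrapT; rewrite -!bigcup_seq => H; apply: nE; apply: HE.
    move=> j; apply: contrapT => nj; apply: H; left.
    by exists j => //=; rewrite mem_index_enum.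
  move=> i; rewrite leNgt; apply/negP => fi; apply: H; right.
  by exists i => //=; rewrite mem_index_enum.
have : (P (~` E) <= (q%:R * ex)%:E)%E.
  apply: (le_trans (le_measure _ _ _ EC)).
  - by rewrite inE; exact: measurableC.
  - rewrite inE; apply: measurableU; apply: bigsetU_measurable => i _ //.
    by have [] := few_le i.
  apply: (le_trans (measureU2 _ _ _)).
  - by apply: bigsetU_measurable => j _.
  - by apply: bigsetU_measurable => i _; have [] := few_le i.
  rewrite -[leRHS]add0e; apply: leeD; rewrite (le_trans (measure_bigsetU_le _ _ _ _))//.
  - by rewrite big1// => j _; exact: (density_outside (Xxi j)).
  - by move=> i; have [] := few_le i.
  apply: (@le_trans _ _ (\sum_(i < q) ex%:E)%E).
    by apply: lee_sum => i _; have [] := few_le i.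
  by rewrite sumEFin sumr_const card_ord mulr_natl.
rewrite probability_setC// -[in P E](fineK (fin_num_measure P E mE)).
rewrite -(fineK (fin_num_measure P E mE)) -EFinB !lee_fin; lra.
Qed.

(** * The sampling inequality *)

Lemma mean_ge_of_hits (R : realFieldType) (n : nat) (A : pred 'I_n) (u : 'I_n -> R) (v a : R) :
  (0 < n)%N -> 0 <= v -> (forall j, 0 <= u j) -> (forall j, A j -> v <= u j) ->
  n%:R * a <= #|A|%:R -> a * v <= n%:R^-1 * \sum_(j < n) u j.
Proof.
move=> n0 v0 u0 Au hits; rewrite [leRHS]mulrC ler_pdivlMr ?ltr0n// mulrAC.
rewrite [a * _]mulrC (le_trans (ler_wpM2r v0 hits))//.
rewrite (bigID A)/= ler_wpDr ?sumr_ge0//.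
rewrite mulr_natl -sumr_const; exact: ler_sum.
Qed.

Lemma mean_le (R : realFieldType) (n : nat) (u : 'I_n -> R) (v : R) :
  (0 < n)%N -> (forall j, u j <= v) -> n%:R^-1 * \sum_(j < n) u j <= v.
Proof.
move=> n0 uv; rewrite mulrC ler_pdivrMr ?ltr0n//.
by rewrite (le_trans (ler_sum _ (fun j _ => uv j)))// sumr_const card_ord mulr_natr.
Qed.

(* Of the bracket in the denominator only gamma Cu m^2 / 3 is kept, and Cu is
   then absorbed by the normalisation [1 <= 4 K^2 Cu]. *)
Lemma bernstein_exponent_le (R : realFieldType) (K Ct Cphi Cl Cu m M C1 gamma e x : R) :
  0 < K -> 0 < Ct -> 0 < e -> 0 < m -> 0 < M -> 0 < Cl -> 1 <= 4 * K ^+ 2 * Cu -> 0 <= x ->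
  C1 <= e ^+ 2 * Ct ^+ 2 * M ^+ 4 / (12 * K * m ^+ 2) ->
  0 < gamma -> gamma <= 2 * K * C1 * Cl / M ^+ 2 ->
  x * m ^+ 4 * gamma ^+ 2 /
      (8 * K ^+ 2 * Ct ^+ 2 * M ^+ 2 *
        (4 * K ^+ 2 * Ct ^+ 2 * Cphi ^+ 2 * Cu +
         gamma * (Cphi ^+ 2 + Cu * m ^+ 2) / 3))
    <= x * (Cl * e ^+ 2) / 4.
Proof.
move=> K0 Ct0 e0 m0 M0 Cl0 KCu x0 C1e g0 gC1.
have Cu0 : 0 < Cu.
  have K4 : 0 < 4 * K ^+ 2 by rewrite mulr_gt0 ?exprn_gt0.
  by rewrite -(pmulr_rgt0 _ K4) (lt_le_trans ltr01).
set D := 4 * K ^+ 2 * Ct ^+ 2 * Cphi ^+ 2 * Cu + _.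
have m20 : 0 < m ^+ 2 by rewrite exprn_gt0.
have M20 : 0 < M ^+ 2 by rewrite exprn_gt0.
have DE : gamma * Cu * m ^+ 2 / 3 <= D.
  have : 0 <= 4 * K ^+ 2 * Ct ^+ 2 * Cphi ^+ 2 * Cu.
    apply: mulr_ge0 (ltW Cu0); apply: mulr_ge0 (sqr_ge0 _).
    by rewrite !mulr_ge0// ltW.
  have : 0 <= gamma * Cphi ^+ 2 := mulr_ge0 (ltW g0) (sqr_ge0 _).
  by rewrite /D; lra.
have D0 : 0 < D by rewrite (lt_le_trans _ DE)// divr_gt0// !mulr_gt0.
rewrite ler_pdivrMr; last by rewrite !mulr_gt0.
have -> : x * m ^+ 4 * gamma ^+ 2 = x * (m ^+ 4 * gamma ^+ 2) by rewrite mulrA.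
have -> : x * (Cl * e ^+ 2) / 4 * (8 * K ^+ 2 * Ct ^+ 2 * M ^+ 2 * D) =
    x * (2 * (Cl * e ^+ 2 * Ct ^+ 2 * M ^+ 2 * K ^+ 2 * D)) by field.
apply: ler_wpM2l => //.
have gM : gamma * M ^+ 2 <= 2 * K * C1 * Cl by rewrite -ler_pdivlMr.
have C1K : C1 * (12 * K * m ^+ 2) <= e ^+ 2 * Ct ^+ 2 * M ^+ 4.
  by rewrite -ler_pdivlMr// !mulr_gt0.
(* The 12 in the bound on [C1] is the 2 of the bound on [gamma] times this 6, which is the value
   that closes the final comparison exactly. *)
have step1 : gamma * M ^+ 2 * m ^+ 2 * 6 <= Cl * (e ^+ 2 * Ct ^+ 2 * M ^+ 4).
  have : gamma * M ^+ 2 * (m ^+ 2 * 6) <= 2 * K * C1 * Cl * (m ^+ 2 * 6).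
    by rewrite ler_pM2r ?mulr_gt0.
  have : Cl * (C1 * (12 * K * m ^+ 2)) <= Cl * (e ^+ 2 * Ct ^+ 2 * M ^+ 4).
    by rewrite ler_pM2l.
  by lra.
have step2 : gamma * m ^+ 2 * 6 <= Cl * e ^+ 2 * Ct ^+ 2 * M ^+ 2.
  rewrite -(ler_pM2r M20).
  have -> : Cl * e ^+ 2 * Ct ^+ 2 * M ^+ 2 * M ^+ 2 = Cl * (e ^+ 2 * Ct ^+ 2 * M ^+ 4) by ring.
  by apply: le_trans step1; rewrite le_eqVlt; apply/orP; left; apply/eqP; ring.
(* The normalisation brings in the factor [Cu] that the retained term of [D] contains. *)
have step3 : gamma * m ^+ 2 * 6 <= Cl * e ^+ 2 * Ct ^+ 2 * M ^+ 2 * (4 * K ^+ 2 * Cu).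
  by rewrite (le_trans step2)// ler_peMr// !mulr_ge0 ?ltW//.
have step4 : gamma * m ^+ 2 * 6 * (gamma * m ^+ 2) <=
    Cl * e ^+ 2 * Ct ^+ 2 * M ^+ 2 * (4 * K ^+ 2 * Cu) * (gamma * m ^+ 2).
  by rewrite ler_pM2r ?mulr_gt0.
have step5 : Cl * e ^+ 2 * Ct ^+ 2 * M ^+ 2 * K ^+ 2 * (gamma * Cu * m ^+ 2 / 3) <=
    Cl * e ^+ 2 * Ct ^+ 2 * M ^+ 2 * K ^+ 2 * D.
  by rewrite ler_wpM2l// !mulr_ge0 ?ltW//.
have -> : m ^+ 4 * gamma ^+ 2 = gamma * m ^+ 2 * 6 * (gamma * m ^+ 2) / 6 by field.
move: step4 step5.
move: (gamma * m ^+ 2 * 6 * (gamma * m ^+ 2)) => L.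
lra.
Qed.

Theorem theorem3p4 (R : realType) (N K : R) (phi : R * R -> R) (m2 M2 : R)
    (theta : R) (hN : 0 < N) (hK : 0 < K)
    (hQ : (1 < #|` lattice_index N K|)%N)
    (phi_cont : continuous phi)
    (phi_supp : compact (supp phi) /\ supp phi `<=` square N)
    (hm2 : 0 < m2) (hmM2 : m2 <= M2)
    (phi_stable : stable_shifts N K phi m2 M2)
    (htheta : 0 <= theta < pi / 2)
    (phi_indep : radon_shifts_independent N K theta phi) :
  let Q : nat := #|` lattice_index N K| in
  let Ct : R := cos theta + sin theta in
  let Cphi : R := sup_shifts N K phi in
  exists C1 C2 : R,
    0 < C1 /\ C1 <= C2 /\
    forall (xi : R * R -> R) (Cl Cu : R),
      0 < Cl ->
      (forall x, square K x -> Cl <= xi x <= Cu) ->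
    forall (n : nat) (d : measure_display) (T : measurableType d)
      (P : probability T R) (X : 'I_n -> {RV P >-> plane R}),
      (0 < n)%N ->
      mutually_independent X ->
      (forall j, has_density_on (square K) xi (X j)) ->
    forall gamma : R,
      0 < gamma < 2 * K * C1 * Cl / M2 ^+ 2 ->
      ((1 - Q%:R * expR (- (n%:R * m2 ^+ 4 * gamma ^+ 2 /
             (8 * K ^+ 2 * Ct ^+ 2 * M2 ^+ 2 *
               (4 * K ^+ 2 * Ct ^+ 2 * Cphi ^+ 2 * Cu +
                gamma * (Cphi ^+ 2 + Cu * m2 ^+ 2) / 3)))))%:E
       <= P [set w | (forall f, signal_space N K phi f ->
              (2 * K * C1 * Cl / M2 ^+ 2 - gamma) * L2norm (square K) f ^+ 2
                <= n%:R^-1 * \sum_(j < n) `|radon_at theta f (X j w)| ^+ 2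
                <= (2 * Num.sqrt 2 * K * C2 * Cu / m2 ^+ 2 + gamma)
                     * L2norm (square K) f ^+ 2)%R])%E.
Proof.
move=> Q Ct Cphi.
pose s : seq (int * int) := lattice_index N K.
have sQ : size s = Q by [].
have s0 : (0 < size s)%N by exact: ltnW.
have [th0 th1] := andP htheta.
have Ct0 : 0 < Ct.
  have ppos := pi_gt0 R.
  rewrite ltr_pwDl ?cos_gt0_pihalf ?sin_ge0_pi//; first by apply/andP; split; lra.
  by apply/andP; split; lra.
have M20 : 0 < M2 by exact: lt_le_trans hmM2.
have [_ sphi] := phi_supp.
have phi_out x : phi x != 0 -> square N x.
  by move=> x0; apply: sphi; exact: (@subset_closure _ [set z | phi z != 0]).
pose g k (x : R * R) := radon theta phi (dotp (direction theta) x
  - dotp (direction theta) (lattice_pt k)).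
have cg k : continuous (g k).
  move=> x; apply: (@continuous_comp _ _ _ (fun y : R * R =>
    dotp (direction theta) y - dotp (direction theta) (lattice_pt k)) (radon theta phi)).
    apply: (@cvgB _ R^o); last exact: cvg_cst.
    by apply: (@cvgD _ R^o); apply: cvgMl_tmp; [exact: cvg_fst|exact: cvg_snd].
  exact: (radon_continuous phi_cont phi_out).
have gE c x : radon_at theta (shift_comb N K phi c) x = \sum_(k <- s) c k * g k x.
  by rewrite (radon_at_shift_comb _ _ _ _ phi_cont sphi).
(* The boxes depend only on the generator, the direction, [N] and [K], hence so will [C1] and [C2],
   up to the stability constants. *)
have [e [dl [b [e0 dl0 bK low]]]] := coercive_boxes hK (fset_uniq _) s0 cg phi_indep.
have [B B0 gB] : exists2 B, 0 < B & forall x, square K x -> \sum_(k <- s) `|g k x| <= B.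
  have [|B B0 HB] := @compact_norm_bound R _ _
    (fun x => \sum_(k <- s) `|g k x|) (@square_compact R K).
    by move=> x; apply: cvg_sumr => k; apply: (@cvg_norm _ R^o); exact: cg.
  by exists B => // x /HB; exact/le_trans/ler_norm.
(* The first entry gives [2 * K * C1 <= e ^+ 2 * dl ^+ 2 / 4], as the lower bound requires when a
   box gets a quarter of its guaranteed hits; the second is for [bernstein_exponent_le]. *)
pose C1 := Num.min (e ^+ 2 * dl ^+ 2 / (8 * K))
  (e ^+ 2 * Ct ^+ 2 * M2 ^+ 4 / (12 * K * m2 ^+ 2)).
have C10 : 0 < C1 by rewrite lt_min !divr_gt0// !mulr_gt0// exprn_gt0.
(* The summand [C1] secures the ordering; the other gives [B ^+ 2 * Q <= 2 * K * C2 * Cu] through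
   [1 <= 4 * K ^+ 2 * Cu]. *)
exists C1, (C1 + 4 * K * B ^+ 2 * Q%:R); split => //; split.
  by rewrite lerDl !mulr_ge0// ltW.
move=> xi Cl Cu Cl0 xiP n d T P X n0 indep Xxi gamma /andP[g0 gC1].
have KCu : 1 <= 4 * K ^+ 2 * Cu.
  exact: (density_sup_ge hK Cl0 xiP (Xxi (Ordinal n0))).
have Cu0 : 0 < Cu.
  have K4 : 0 < 4 * K ^+ 2 by rewrite mulr_gt0 ?exprn_gt0.
  by rewrite -(pmulr_rgt0 _ K4) (lt_le_trans ltr01).
apply: le_trans (sampling_probability hK Cl0 xiP indep Xxi e0 bK _ _); last 2 first.
- exact: measurable_sampling_event.
- move=> w Xw hits _ [c ->].
  pose S := \sum_(k <- s) `|c k|; pose L := L2norm (square K) (shift_comb N K phi c).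
  pose l2 := \sum_(k <- s) c k ^+ 2.
  have l20 : 0 <= l2 by rewrite sumr_ge0// => k _; exact: sqr_ge0.
  have l2E : l2norm N K c ^+ 2 = l2 by rewrite sqr_sqrtr.
  have S0 : 0 <= S by rewrite sumr_ge0.
  have l2S : l2 <= S ^+ 2 by exact: sum_sqr_le_sqr_l1.
  have Sl2 : S ^+ 2 <= Q%:R * l2 by exact: sqr_l1_le_sum_sqr.
  have l2n0 : 0 <= l2norm N K c by exact: sqrtr_ge0.
  have L0 : 0 <= L by exact: sqrtr_ge0.
  have [mL LM] := andP (phi_stable c); rewrite -/L in mL LM.
  have mL2 : m2 ^+ 2 * l2 <= L ^+ 2.
    by rewrite -l2E -exprMn ler_pXn2r// nnegrE mulr_ge0// ltW.
  have LM2 : L ^+ 2 <= M2 ^+ 2 * l2.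
    by rewrite -l2E -exprMn ler_pXn2r// nnegrE mulr_ge0// ltW.
  apply/andP; split.
    (* The box depends on [c], but [hits] covers all boxes at once, so one sample configuration
       serves every [f]. *)
    have [i Hi] := low c.
    have a0 : 0 <= Cl * e ^+ 2 / 4 by rewrite divr_ge0// mulr_ge0 ?sqr_ge0// ltW.
    apply: (@le_trans _ _ (Cl * e ^+ 2 / 4 * (dl * S) ^+ 2)); last first.
      apply: (@mean_ge_of_hits _ _ [pred j | X j w \in box e (b i)]) => //.
      - exact: sqr_ge0.
      - move=> j /set_mem/Hi; rewrite -gE => H.
        by rewrite ler_pXn2r ?nnegrE// mulr_ge0// ltW.
      - by rewrite mulrA; exact: hits.
    have C1l : C1 * (8 * K) <= e ^+ 2 * dl ^+ 2.
      by rewrite -ler_pdivlMr ?mulr_gt0// ge_min lexx.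
    have : (2 * K * C1 * Cl / M2 ^+ 2 - gamma) * L ^+ 2 <= 2 * K * C1 * Cl * l2.
      apply: (@le_trans _ _ (2 * K * C1 * Cl / M2 ^+ 2 * L ^+ 2)).
        by rewrite ler_wpM2r ?sqr_ge0// gerBl ltW.
      rewrite -mulrA ler_pM2l ?mulr_gt0//.
      by rewrite mulrC ler_pdivrMr ?exprn_gt0// mulrC.
    move/le_trans; apply.
    apply: (@le_trans _ _ (2 * K * C1 * Cl * S ^+ 2)).
      by rewrite ler_wpM2l// !mulr_ge0// ltW.
    have : Cl * S ^+ 2 * (C1 * (8 * K)) <= Cl * S ^+ 2 * (e ^+ 2 * dl ^+ 2).
      by rewrite ler_wpM2l// mulr_ge0 ?sqr_ge0// ltW.
    by rewrite exprMn; lra.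
  (* Each sample is at most [B * S] in absolute value because all points lie in the square; then
     [S ^+ 2 <= Q * l2] and stability pass to the norm of [f]. *)
  apply: (@le_trans _ _ (B ^+ 2 * S ^+ 2)).
    apply: mean_le => // j; rewrite -exprMn ler_pXn2r ?nnegrE ?mulr_ge0// ?(ltW B0)//.
    rewrite gE (le_trans (norm_sum_mul_le _ _ _))// mulrC ler_wpM2r//.
    exact: gB.
  have sq2 : 1 <= Num.sqrt 2 :> R by rewrite -[leLHS]sqrtr1 ler_wsqrtr// ler1n.
  set Z := 4 * K * B ^+ 2 * Q%:R; set Y := 2 * Num.sqrt 2 * K * (C1 + Z) * Cu.
  have BQ : 0 <= B ^+ 2 * Q%:R by rewrite mulr_ge0 ?sqr_ge0.
  have Z0 : 0 <= Z by rewrite !mulr_ge0 // ltW.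
  have lY : B ^+ 2 * Q%:R <= Y.
    apply: (@le_trans _ _ (2 * K * Z * Cu)).
      have : B ^+ 2 * Q%:R * 1 <= B ^+ 2 * Q%:R * (4 * K ^+ 2 * Cu) by rewrite ler_wpM2l.
      by rewrite /Z; lra.
    have -> : Y = 2 * K * (Num.sqrt 2 * (C1 + Z)) * Cu by rewrite /Y; ring.
    rewrite ler_pM2r// ler_pM2l ?mulr_gt0//.
    apply: (@le_trans _ _ (C1 + Z)); first by rewrite lerDr ltW.
    by rewrite ler_peMl// addr_ge0// ltW.
  have Y0 : 0 <= Y by exact: le_trans lY.
  apply: (@le_trans _ _ (Y * l2)).
    rewrite (@le_trans _ _ (B ^+ 2 * (Q%:R * l2)))//.
      by rewrite ler_wpM2l ?sqr_ge0.
    by rewrite mulrA ler_wpM2r.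
  apply: (@le_trans _ _ (Y / m2 ^+ 2 * L ^+ 2)).
    rewrite -mulrA ler_wpM2l//.
    by rewrite mulrC ler_pdivlMr ?exprn_gt0// mulrC.
  by rewrite ler_wpM2r ?sqr_ge0// lerDl ltW.
(* What remains is that the stated exponent is at most the Chernoff exponent. *)
rewrite lee_fin lerD2l lerN2 ler_wpM2l// ler_expR lerN2.
have C1e : C1 <= e ^+ 2 * Ct ^+ 2 * M2 ^+ 4 / (12 * K * m2 ^+ 2).
  by rewrite ge_min lexx orbT.
exact: (bernstein_exponent_le _ hK Ct0 e0 hm2 M20 Cl0 KCu (ler0n _ _) C1e g0 (ltW gC1)).
Qed.
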